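(* Let $n,k,\delta$ be positive integers with $2\le k\le n$. Put $$\alpha=(k-1)\,\mathrm{lcm}(1,2,\dots,\delta),\qquad d_i=(i+1)(k-1)\ \ (1\le i\le\delta),\qquad D=\{d_1,\dots,d_\delta\},$$ $$\beta(d_i)=\frac{\alpha}{d_i-k+1},\qquad \gamma(d_i)=d_i\,\beta(d_i)\qquad(1\le i\le\delta).$$ Then there exist a finite field $\mathbb{F}_q$ and a bandwidth adaptive regenerating code $\mathcal{C}(n,k,D,\alpha,\gamma)$ over $\mathbb{F}_q$ with exact repair that stores a file of $k\alpha$ symbols of $\mathbb{F}_q$, and the total storage capacity satisfies $F(n,k,D,\alpha,\gamma)=k\alpha$. That is, the code is a bandwidth adaptive MSR code with per-node storage capacity $\alpha$ and total storage capacity $F=k\alpha$, which performs exact repair of any failed node using any arbitrary $d_i$ helpers, for every $i\in\{1,\dots,\delta\}$, with each helper sending $\beta(d_i)=\alpha/(d_i-k+1)$ symbols, simultaneously for all $i$.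
   Context: All symbols stored or transmitted are elements of a finite field $\mathbb{F}_q$; $\mathrm{lcm}$ denotes least common multiple. There are $n$ storage nodes, each storing $\alpha$ symbols. Bandwidth adaptive regenerating code (with exact repair). Given $\alpha,n,k$, a set $D=\{d_1<\dots<d_\delta\}$ of positive integers, and a function $\gamma:D\to[\alpha,\infty)$, write $\beta(d)=\gamma(d)/d$ for $d\in D$. A code $\mathcal{C}(n,k,D,\alpha,\gamma)$ over $\mathbb{F}_q$ storing a file of $F$ symbols consists of encoding maps $x_1,\dots,x_n:\mathbb{F}_q^F\to\mathbb{F}_q^\alpha$ ($x_j(s)$ is the content of node $j$ when the file is $s$) such that: (i) Data reconstruction: for every set of $k$ nodes, the file $s$ is determined by (is a function of) the contents of these $k$ nodes. (ii) Exact repair, for every $d\in D$: for every failed node $f$ and every set $\mathcal{H}$ of $d$ nodes not containing $f$ (the helpers), there are functions by which each helper $h\in\mathcal{H}$ computes $\beta(d)$ symbols of $\mathbb{F}_q$ from its own content $x_h(s)$, such that the exact content $x_f(s)$ of the failed node is a function of the $d\,\beta(d)$ symbols so obtained. (For $d>n-1$ the condition is vacuous.) The same code (encoding) must satisfy the repair condition for all $d\in D$ simultaneously. Total storage capacity: $F(n,k,D,\alpha,\gamma)$ is the maximum size (number of symbols) of a file that can be stored by a bandwidth adaptive regenerating code $\mathcal{C}(n,k,D,\alpha,\gamma)$. Bandwidth adaptive MSR code: a bandwidth adaptive regenerating code that realizes $F(n,k,D,\alpha,\gamma)=k\alpha$ (MDS property) and $\alpha=(d-k+1)\beta(d)$ for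 all $d\in D$. *)

(* Defs.v *)
From HB Require Import structures.
From mathcomp Require Import all_boot all_order all_algebra.

Set Implicit Arguments.
Unset Strict Implicit.
Unset Printing Implicit Defensive.

Import Order.TTheory GRing.Theory Num.Theory.
Local Open Scope ring_scope.

(* In this file [n] is the number of nodes, [alpha] the number of symbols per
   node and [B] the number of symbols of the file.  A family of encoding maps is
   [x : 'I_n -> 'rV[Fq]_B -> 'rV[Fq]_alpha], where [x j s] is the content of
   node [j] when the file is [s]; the maps need not be linear.  "The symbols
   held by the nodes of A" is a finite function on the subtype
   [{j | j \in A}], so a decoder has access to nothing else. *)

Definition data_reconstruction (Fq : finFieldType) (n B alpha : nat) (k : nat)
    (x : 'I_n -> 'rV[Fq]_B -> 'rV[Fq]_alpha) : Prop :=
  forall K : {set 'I_n}, #|K| = k ->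
  exists dec : {ffun {j | j \in K} -> 'rV[Fq]_alpha} -> 'rV[Fq]_B,
  forall s : 'rV[Fq]_B, dec [ffun j => x (val j) s] = s.

(* Helper maps and the decoder may depend on the failed node and on the set of
   helpers.  For [d > n - 1] there is no such pair. *)
Definition exact_repair (Fq : finFieldType) (n B alpha : nat) (d b : nat)
    (x : 'I_n -> 'rV[Fq]_B -> 'rV[Fq]_alpha) : Prop :=
  forall (f : 'I_n) (H : {set 'I_n}), #|H| = d -> f \notin H ->
  exists (help : {h | h \in H} -> 'rV[Fq]_alpha -> 'rV[Fq]_b)
         (dec : {ffun {h | h \in H} -> 'rV[Fq]_b} -> 'rV[Fq]_alpha),
  forall s : 'rV[Fq]_B, dec [ffun h => help h (x (val h) s)] = x f s.

Definition per_helper (gamma : nat -> rat) (d : nat) : rat := gamma d / d%:R.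

(* The set D = {d_1 < ... < d_delta} is a strictly increasing sequence; only the
   values of [gamma] on it are used.  As a number of transmitted symbols,
   beta(d) = gamma(d)/d has to be a natural number [b]. *)
Definition adaptive_regenerating_code (Fq : finFieldType) (n B alpha : nat)
    (k : nat) (D : seq nat) (gamma : nat -> rat)
    (x : 'I_n -> 'rV[Fq]_B -> 'rV[Fq]_alpha) : Prop :=
  [/\ sorted ltn D,
      forall d, d \in D -> (0 < d)%N /\ alpha%:R <= gamma d,
      data_reconstruction k x
    & forall d, d \in D ->
        exists2 b : nat, b%:R = per_helper gamma d & exact_repair d b x].

(* The maximum is over codes over all finite fields. *)
Definition total_storage_capacity (n k : nat) (D : seq nat) (alpha : nat)
    (gamma : nat -> rat) (F : nat) : Prop :=
  (exists (Fq : finFieldType) (x : 'I_n -> 'rV[Fq]_F -> 'rV[Fq]_alpha),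
     adaptive_regenerating_code k D gamma x) /\
  (forall (Fq : finFieldType) (B : nat)
          (x : 'I_n -> 'rV[Fq]_B -> 'rV[Fq]_alpha),
     adaptive_regenerating_code k D gamma x -> (B <= F)%N).

Definition adaptive_MSR_code (Fq : finFieldType) (n B alpha : nat)
    (k : nat) (D : seq nat) (gamma : nat -> rat)
    (x : 'I_n -> 'rV[Fq]_B -> 'rV[Fq]_alpha) : Prop :=
  [/\ adaptive_regenerating_code k D gamma x,
      B = (k * alpha)%N,
      total_storage_capacity n k D alpha gamma (k * alpha)
    & forall d, d \in D ->
        alpha%:R = (d%:R - k%:R + 1) * per_helper gamma d].

(* Main.v *)
Require Import Defs.
From HB Require Import structures.
From mathcomp Require Import all_boot all_order all_algebra.
From mathcomp Require Import ring.

Set Implicit Arguments.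
Unset Strict Implicit.
Unset Printing Implicit Defensive.

Import Order.TTheory GRing.Theory Num.Theory.
Local Open Scope ring_scope.

(* Put a = k - 1, z = lcm(1, ..., delta).  The file is a chain of symmetric
   a x a matrices R_0 = 0, P_0, R_1, P_1, ..., R_z, and node h, with evaluation
   point e_h, phi_h = (1, e_h, ..., e_h^(a-1)) and l_h = e_h^a, stores the z
   vectors c_(h,t) = (R_t + l_h P_t + l_h^2 R_(t+1)) phi_h.
   Any a + 1 nodes recover the pairs (P_t, R_(t+1)) one after the other, R_t
   being known, as in the product-matrix MSR code.  To repair f with (i+1) a
   helpers, cut the chain into z/i windows of length i; for the window starting
   at t, helper h sends sum_(u < i) (l_h l_f)^u phi_f^T c_(h,t+u).  By symmetry
   this is linear in phi_h, and up to the already known R_t phi_f and a factor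
   l_h it is the value at e_h of a polynomial of degree < (i+1) a, whose
   coefficients yield the cells of f in the window and R_(t+i) phi_f, which
   starts the next window.
   The code is linear, so each decoder is obtained from a kernel computation;
   the points e_h = h + 1 modulo a prime p > n^a have distinct nonzero a-th
   powers. *)

(** * Decoders from injectivity *)

(** The decoder picks any preimage of the received data and applies [g]; [y0] is the value on data
    that no [s] produces. *)
Lemma decoder_exists (S X Y : finType) (f : S -> X) (g : S -> Y) (y0 : Y) :
  (forall s s', f s = f s' -> g s = g s') ->
  exists dec : X -> Y, forall s, dec (f s) = g s.
Proof.
move=> fg; exists (fun v => oapp g y0 [pick s | f s == v]) => s.
by case: pickP => [s' /eqP /fg // | /(_ s)]; rewrite eqxx.
Qed.

(** * Evaluation vectors and Vandermonde separation *)

Definition powers (F : fieldType) (a : nat) (e : F) : 'cV[F]_a :=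
  \col_(j < a) e ^+ j.

Definition dot (F : fieldType) (a : nat) (e : F) (w : 'cV[F]_a) : F :=
  ((powers a e)^T *m w) 0 0.

Lemma dot_horner (F : fieldType) (a : nat) (e : F) (w : 'cV[F]_a) :
  dot e w = (rVpoly w^T).[e].
Proof.
rewrite /dot mxE horner_poly; apply: eq_bigr => j _.
rewrite !mxE insubT ?ltn_ord //= => lt_j; rewrite mxE mulrC.
by congr (w _ _ * _); apply: val_inj.
Qed.

Lemma rVpoly_tr_eq0 (F : fieldType) (a : nat) (w : 'cV[F]_a) :
  rVpoly w^T = 0 -> w = 0.
Proof.
move=> /(congr1 (@poly_rV _ a)); rewrite rVpolyK linear0.
by move=> /(congr1 trmx); rewrite trmxK trmx0.
Qed.

(** The blocks occupy disjoint ranges of degrees: block 0 is read off below degree [a], and the rest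
    is divisible by ['X^a]. *)
Lemma poly_blocks_eq0 (F : fieldType) (a m : nat) (p : nat -> {poly F}) :
  (forall v, size (p v) <= a)%N ->
  \sum_(v < m) p v * 'X^(a * v) = 0 -> forall v, (v < m)%N -> p v = 0.
Proof.
elim: m p => // m IHm p szp.
rewrite big_ord_recl muln0 expr0 mulr1.
under eq_bigr => i _ do rewrite lift0 mulnS addnC exprD mulrA.
rewrite -mulr_suml => eq0.
have p00 : p 0%N = 0.
  apply/polyP => j; rewrite coef0; case: (ltnP j a) => [lt_ja | le_aj].
    have := congr1 (fun q : {poly F} => q`_j) eq0.
    by rewrite coefD coefMXn lt_ja addr0 coef0.
  by rewrite nth_default // (leq_trans (szp 0%N)).
move: eq0; rewrite p00 add0r => /eqP.
rewrite mulf_eq0 expf_eq0 polyX_eq0 andbF orbF.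
move=> /eqP eq0 [|v] // lt_v.
exact: (IHm (fun i => p i.+1)).
Qed.

(** The sum is the value at [e h] of a polynomial of size at most [m * a], which thus has at least
    as many distinct roots as coefficients. *)
Lemma vandermonde_blocks (F : fieldType) (I : finType) (a m : nat) (e : I -> F)
    (H : {set I}) (w : nat -> 'cV[F]_a) :
  {in H &, injective e} -> (m * a <= #|H|)%N ->
  (forall h, h \in H ->
     \sum_(v < m) e h ^+ (a * v) * dot (e h) (w v) = 0) ->
  forall v, (v < m)%N -> w v = 0.
Proof.
move=> inj_e leH eq0 v lt_vm; apply: rVpoly_tr_eq0.
apply: (@poly_blocks_eq0 _ a m (fun v => rVpoly (w v)^T)) => // [u|].
  exact: size_poly.
set q := \sum_(_ < m) _.
apply: (@roots_geq_poly_eq0 _ _ [seq e h | h <- enum H]).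
- apply/allP => x /mapP[h + ->]; rewrite mem_enum => hH.
  rewrite /root horner_sum -[X in _ == X](eq0 h hH); apply/eqP.
  by apply: eq_bigr => u _; rewrite hornerM hornerXn dot_horner mulrC.
- by rewrite map_inj_in_uniq ?enum_uniq // => x y; rewrite !mem_enum; apply: inj_e.
- rewrite size_map -cardE; apply: leq_trans leH.
  apply: leq_trans (size_sum _ _ _) _; apply/bigmax_leqP => u _.
  apply: leq_trans (size_polyMleq _ _) _; rewrite size_polyXn addnS /=.
  have szu : (size (rVpoly (w u)^T) <= a)%N := size_poly _ _.
  apply: leq_trans (leq_add szu (leqnn _)) _.
  by rewrite -mulnS mulnC leq_mul2r ltn_ord orbT.
Qed.

Lemma dotD (F : fieldType) (a : nat) (e : F) (v w : 'cV[F]_a) :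
  dot e (v + w) = dot e v + dot e w.
Proof. by rewrite /dot mulmxDr mxE. Qed.

Lemma dotZ (F : fieldType) (a : nat) (e c : F) (w : 'cV[F]_a) :
  dot e (c *: w) = c * dot e w.
Proof. by rewrite /dot -scalemxAr mxE. Qed.

Lemma dot0 (F : fieldType) (a : nat) (e : F) : dot e (0 : 'cV[F]_a) = 0.
Proof. by rewrite /dot mulmx0 mxE. Qed.

Lemma dot_sym (F : fieldType) (a : nat) (e e' : F) (S : 'M[F]_a) :
  S^T = S -> dot e (S *m powers a e') = dot e' (S *m powers a e).
Proof.
move=> symS; rewrite /dot.
transitivity (((powers a e)^T *m (S *m powers a e'))^T 0 0).
  by rewrite [RHS]mxE.
by rewrite !trmx_mul trmxK symS mulmxA.
Qed.

(** * Cells stored by a node *)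

(** The chains [P] and [R] are indexed by all of [nat], so that shifting the index yields chains
    again. *)
Definition cell (F : fieldType) (a : nat) (P R : nat -> 'M[F]_a) (e : F)
    (t : nat) : 'cV[F]_a :=
  (R t + e ^+ a *: P t + (e ^+ a) ^+ 2 *: R t.+1) *m powers a e.

(** Symmetry exchanges the two points: what helper [e] sends to [e'] becomes a pairing of the vector
    of [e] with unknowns of [e']. *)
Lemma dot_cell_sym (F : fieldType) (a : nat) (P R : nat -> 'M[F]_a)
    (e e' : F) (t : nat) :
  (forall t, (P t)^T = P t) -> (forall t, (R t)^T = R t) ->
  dot e' (cell P R e t) = dot e (R t *m powers a e')
    + e ^+ a * dot e (P t *m powers a e')
    + (e ^+ a) ^+ 2 * dot e (R t.+1 *m powers a e').
Proof.
move=> symP symR; rewrite /cell !mulmxDl -!scalemxAl !dotD !dotZ.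
by rewrite !(@dot_sym _ _ e' e).
Qed.

Lemma dot_cell (F : fieldType) (a : nat) (P R : nat -> 'M[F]_a)
    (e e' : F) (t : nat) :
  dot e (cell P R e' t) = dot e (R t *m powers a e')
    + e' ^+ a * dot e (P t *m powers a e')
    + (e' ^+ a) ^+ 2 * dot e (R t.+1 *m powers a e').
Proof. by rewrite /cell !mulmxDl -!scalemxAl !dotD !dotZ. Qed.

Lemma dot_separates (F : fieldType) (I : finType) (a : nat) (e : I -> F)
    (H : {set I}) (w : 'cV[F]_a) :
  {in H &, injective e} -> (a <= #|H|)%N ->
  (forall h, h \in H -> dot (e h) w = 0) -> w = 0.
Proof.
move=> inj_e leH eq0.
apply: (@vandermonde_blocks F I a 1 e H (fun=> w) inj_e _ _ 0%N) => //.
  by rewrite mul1n.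
by move=> h hH; rewrite big_ord1 muln0 expr0 mul1r; apply: eq0.
Qed.

Lemma powers_separate (F : fieldType) (I : finType) (a : nat) (e : I -> F)
    (H : {set I}) (S : 'M[F]_a) :
  {in H &, injective e} -> (a <= #|H|)%N -> S^T = S ->
  (forall h, h \in H -> S *m powers a (e h) = 0) -> S = 0.
Proof.
move=> inj_e leH symS eq0; apply/matrixP => i j.
suff /colP/(_ i) : col j S = 0 by rewrite !mxE.
apply: (dot_separates inj_e leH) => h hH.
by rewrite /dot colE mulmxA -symS -trmx_mul eq0 // trmx0 mul0mx mxE.
Qed.

(** * Data reconstruction from a + 1 nodes *)

(** Pair the equation of [h] with the vector of [h'] and conversely: by symmetry the [P] terms
    agree, and distinct [a]-th powers kill the off-diagonal [R] terms. Each [R *m powers a (e h')]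
    is then orthogonal to at least [a] independent vectors. *)
Lemma symmetric_pair_eq0 (F : fieldType) (I : finType) (a : nat) (e : I -> F)
    (K : {set I}) (P R : 'M[F]_a) :
  {in K &, injective e} -> {in K &, injective (fun h => e h ^+ a)} ->
  (a < #|K|)%N -> P^T = P -> R^T = R ->
  (forall h, h \in K -> (P + e h ^+ a *: R) *m powers a (e h) = 0) ->
  P = 0 /\ R = 0.
Proof.
move=> inj_e inj_ea ltK symP symR eq0.
have off h h' : h \in K -> h' \in K -> h != h' ->
    dot (e h) (R *m powers a (e h')) = 0.
  move=> hK h'K neq_h.
  have := congr1 (dot (e h')) (eq0 h hK); have := congr1 (dot (e h)) (eq0 h' h'K).
  rewrite !mulmxDl -!scalemxAl !dotD !dotZ !dot0 !(dot_sym (e h') (e h)) //.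
  move=> E E'.
  have /eqP : (e h' ^+ a - e h ^+ a) * dot (e h) (R *m powers a (e h')) = 0.
    rewrite mulrBl; apply/eqP; rewrite subr_eq0; apply/eqP.
    by apply: (addrI (dot (e h) (P *m powers a (e h')))); rewrite E E'.
  rewrite mulf_eq0 subr_eq0 => /orP[/eqP eq_ea | /eqP //].
  by rewrite (inj_ea h' h) ?eqxx in neq_h.
have R0 : R = 0.
  apply: (powers_separate inj_e (ltnW ltK) symR) => h' h'K.
  apply: (@dot_separates _ _ _ e (K :\ h')) => [h1 h2|| h].
  - by rewrite !inE => /andP[_ ?] /andP[_ ?]; apply: inj_e.
  - by rewrite (cardsD1 h') h'K in ltK.
  - by rewrite !inE => /andP[neq_h hK]; apply: off.
split=> //; apply: (powers_separate inj_e (ltnW ltK) symP) => h hK.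
by have := eq0 h hK; rewrite R0 scaler0 addr0.
Qed.

Lemma cells_determine (F : fieldType) (I : finType) (a z : nat) (e : I -> F)
    (K : {set I}) (P R : nat -> 'M[F]_a) :
  {in K &, injective e} -> {in K &, injective (fun h => e h ^+ a)} ->
  (forall h, h \in K -> e h != 0) -> (a < #|K|)%N ->
  (forall t, (P t)^T = P t) -> (forall t, (R t)^T = R t) -> R 0%N = 0 ->
  (forall h t, h \in K -> (t < z)%N -> cell P R (e h) t = 0) ->
  forall t, (t < z)%N -> P t = 0 /\ R t.+1 = 0.
Proof.
move=> inj_e inj_ea e_neq0 ltK symP symR R0 eq0.
suff step t : (t < z)%N -> R t = 0 -> P t = 0 /\ R t.+1 = 0.
  move=> t lt_tz; apply: (step t lt_tz).
  elim: t lt_tz => // t IHt lt_tz.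
  by case: (step t (ltnW lt_tz) (IHt (ltnW lt_tz))).
(* With [R t = 0], the cell is the nonzero factor [e h ^+ a] times the expression for the pair
   [P t], [R t.+1]. *)
move=> lt_tz Rt0; apply: (symmetric_pair_eq0 inj_e inj_ea) => // h hK.
have := eq0 h t hK lt_tz; rewrite /cell Rt0 add0r expr2 -scalerA -scalerDr.
rewrite -scalemxAl => /eqP; rewrite scaler_eq0 expf_eq0 (negPf (e_neq0 h hK)).
by rewrite andbF => /eqP.
Qed.

(** * Exact repair, window by window *)

(* With r_u and p_u the pairings of R_u phi_f and P_u phi_f with phi_h, and
   m = l_h, l = l_f, the left side is l times what helper h sends, and the terms
   r_u + l p_u + l^2 r_(u+1) on the right are the cells of f paired with phi_h. *)
Lemma helper_telescope (F : fieldType) (i : nat) (l m : F) (r p : nat -> F) :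
  l * \sum_(u < i) (m * l) ^+ u * (r u + m * p u + m ^+ 2 * r u.+1) =
  m * \sum_(u < i) (m * l) ^+ u * (r u + l * p u + l ^+ 2 * r u.+1)
    + (l - m) * (r 0%N - (m * l) ^+ i * r i).
Proof.
elim: i => [|i IHi]; first by rewrite !big_ord0; ring.
by rewrite !big_ord_recr /= mulrDr IHi [(m * l) ^+ i.+1]exprS; ring.
Qed.

Lemma repair_chunk (F : fieldType) (I : finType) (a i : nat) (e : I -> F)
    (H : {set I}) (P R : nat -> 'M[F]_a) (ef : F) :
  {in H &, injective e} -> (forall h, h \in H -> e h != 0) -> ef != 0 ->
  (i.+2 * a <= #|H|)%N ->
  (forall t, (P t)^T = P t) -> (forall t, (R t)^T = R t) ->
  R 0%N *m powers a ef = 0 ->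
  (forall h, h \in H -> \sum_(u < i.+1) (e h ^+ a * ef ^+ a) ^+ u
                          * dot ef (cell P R (e h) u) = 0) ->
  R i.+1 *m powers a ef = 0 /\
  forall u, (u < i.+1)%N -> cell P R ef u = 0.
Proof.
move=> inj_e e_neq0 ef_neq0 leH symP symR R0 eq0.
set l := ef ^+ a; have l_neq0 : l != 0 by rewrite expf_neq0.
pose r := R i.+1 *m powers a ef.
(* These are the coefficients in [m] left by [helper_telescope] after division by [m]; the boundary
   term [(l - m) * r] contributes to the last two. *)
pose w v := if (v < i)%N then l ^+ v *: cell P R ef v
            else if v == i then l ^+ i *: cell P R ef i - l ^+ i.+2 *: r
            else l ^+ i.+1 *: r.
have w0 : forall v, (v < i.+2)%N -> w v = 0.
  apply: (vandermonde_blocks inj_e leH) => h hH.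
  pose m := e h ^+ a; have m_neq0 : m != 0 by rewrite expf_neq0 ?e_neq0.
  apply: (mulfI m_neq0); rewrite mulr0.
  pose rr t := dot (e h) (R t *m powers a ef).
  pose pp t := dot (e h) (P t *m powers a ef).
  have := helper_telescope i.+1 l m rr pp.
  have -> : \sum_(u < i.+1)
      (m * l) ^+ u * (rr u + m * pp u + m ^+ 2 * rr u.+1) = 0.
    by rewrite -[RHS](eq0 h hH); apply: eq_bigr => u _; rewrite dot_cell_sym.
  have -> : rr 0%N = 0 by rewrite /rr R0 dot0.
  rewrite mulr0 sub0r => E; rewrite [RHS]E {E}.
  rewrite [in LHS]big_ord_recr [in LHS]big_ord_recr /= [in RHS]big_ord_recr /=.
  rewrite {2 3}/w ltnn eqxx ltnNge leqnSn /= gtn_eqF //.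
  rewrite -scaleNr !dotD !dotZ dot_cell.
  have -> : \sum_(j < i) e h ^+ (a * j) * dot (e h) (w j) =
            \sum_(j < i) (m * l) ^+ j * (rr j + l * pp j + l ^+ 2 * rr j.+1).
    apply: eq_bigr => j _; rewrite /w ltn_ord dotZ dot_cell exprM exprMn.
    by rewrite -/m -/l -/(rr _) -/(rr _) -/(pp _); ring.
  rewrite !exprM -/m -/l -/(rr i) -/(pp i) -/(rr i.+1) !exprMn !exprS.
  by rewrite /r -/(rr i.+1); ring.
(* The top coefficient gives [r = 0], after which every other one is a nonzero multiple of a
   cell. *)
have r0 : r = 0.
  have /eqP := w0 i.+1 (ltnSn _); rewrite /w ltnNge leqnSn /= gtn_eqF //.
  by rewrite scaler_eq0 expf_eq0 (negPf l_neq0) andbF => /eqP.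
split=> // u; rewrite ltnS => le_ui; have /eqP := w0 u (leqW le_ui).
rewrite /w r0 scaler0 subr0; case: ltnP => [_ | le_iu].
  by rewrite scaler_eq0 expf_eq0 (negPf l_neq0) andbF => /eqP.
have -> : u = i by apply/eqP; rewrite eqn_leq le_ui.
by rewrite eqxx scaler_eq0 expf_eq0 (negPf l_neq0) andbF => /eqP.
Qed.

Lemma repair_cells (F : fieldType) (I : finType) (a i b : nat) (e : I -> F)
    (H : {set I}) (P R : nat -> 'M[F]_a) (ef : F) :
  (0 < i)%N ->
  {in H &, injective e} -> (forall h, h \in H -> e h != 0) -> ef != 0 ->
  (i.+1 * a <= #|H|)%N ->
  (forall t, (P t)^T = P t) -> (forall t, (R t)^T = R t) -> R 0%N = 0 ->
  (forall h m, h \in H -> (m < b)%N ->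
     \sum_(u < i) (e h ^+ a * ef ^+ a) ^+ u
        * dot ef (cell P R (e h) (m * i + u)) = 0) ->
  forall t, (t < b * i)%N -> cell P R ef t = 0.
Proof.
case: i => // i _ inj_e e_neq0 ef_neq0 leH symP symR R0 eq0.
have chunk m : (m < b)%N -> R (m * i.+1)%N *m powers a ef = 0 ->
    R (m.+1 * i.+1)%N *m powers a ef = 0 /\
    forall u, (u < i.+1)%N -> cell P R ef (m * i.+1 + u) = 0.
  move=> lt_mb Rm0.
  have := @repair_chunk F I a i e H (fun t => P (m * i.+1 + t)%N)
            (fun t => R (m * i.+1 + t)%N) ef.
  rewrite addn0 => /(_ inj_e e_neq0 ef_neq0 leH (fun=> symP _) (fun=> symR _) Rm0).
  case=> [h hH | ].
  - by rewrite -[RHS](eq0 h m hH lt_mb); apply: eq_bigr => u _;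
       rewrite /cell addnS.
  - rewrite mulSn addnC => R1 cells; split=> // u /cells.
    by rewrite /cell addnS.
(* Each window hands the vanishing of its final [R] on the failed node's vector to the next. *)
have start m : (m < b)%N -> R (m * i.+1)%N *m powers a ef = 0.
  elim: m => [|m IHm] lt_mb; first by rewrite R0 mul0mx.
  by case: (chunk m (ltnW lt_mb) (IHm (ltnW lt_mb))).
move=> t lt_t; have lt_m : (t %/ i.+1 < b)%N by rewrite ltn_divLR.
rewrite (divn_eq t i.+1).
by apply: (chunk _ lt_m (start _ lt_m)).2; rewrite ltn_pmod.
Qed.

(** * Cutting the file into symmetric matrices *)

(** The indicator vector admits any natural number [t], giving zero from [z] on, and keeps the map
    linear in [M]. *)
Definition column (F : fieldType) (a z : nat) (M : 'M[F]_(a, z)) (t : nat) :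
    'cV[F]_a :=
  M *m \col_(t' < z) (t' == t :> nat)%:R.

Lemma columnE (F : fieldType) (a z : nat) (M : 'M[F]_(a, z)) (t : 'I_z) :
  column M t = col t M.
Proof.
by rewrite colE; congr (_ *m _); apply/colP => t'; rewrite !mxE andbT.
Qed.

(** Block [t] has [a * a.+1] entries, as many as the free entries of two symmetric [a] x [a]
    matrices. *)
Definition file_block (F : fieldType) (a z : nat) (s : 'rV[F]_(a.+1 * (a * z)))
    (t : nat) : 'M[F]_(a, a.+1) :=
  \matrix_(i, r) column (vec_mx (row r (vec_mx s))) t i 0.

Lemma file_blockB (F : fieldType) (a z : nat) (s s' : 'rV[F]_(a.+1 * (a * z)))
    (t : nat) :
  file_block (s - s') t = file_block s t - file_block s' t.
Proof.
apply/matrixP => i r; rewrite !mxE -sumrB.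
by apply: eq_bigr => j _; rewrite !mxE mulrBl.
Qed.

Lemma file_block_inj (F : fieldType) (a z : nat) (s : 'rV[F]_(a.+1 * (a * z))) :
  (forall t, (t < z)%N -> file_block s t = 0) -> s = 0.
Proof.
move=> eq0; apply: (can_inj vec_mxK); rewrite linear0.
apply/row_matrixP => r; rewrite row0; apply: (can_inj vec_mxK); rewrite linear0.
apply/matrixP => i t; have /matrixP/(_ i r) := eq0 t (ltn_ord t).
by rewrite mxE columnE !mxE.
Qed.

(* An a x (a + 1) block splits into a weakly lower and a strictly upper
   triangle, each of which fills one symmetric a x a matrix. *)
Definition sym_lower (F : fieldType) (a : nat) (A : 'M[F]_(a, a.+1)) : 'M[F]_a :=
  \matrix_(i, j) if (j <= i)%N then A i (lift ord_max j) else A j (lift ord_max i).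

Definition sym_upper (F : fieldType) (a : nat) (A : 'M[F]_(a, a.+1)) : 'M[F]_a :=
  \matrix_(i, j) if (i <= j)%N then A i (lift ord0 j) else A j (lift ord0 i).

Lemma sym_lower_sym (F : fieldType) (a : nat) (A : 'M[F]_(a, a.+1)) :
  (sym_lower A)^T = sym_lower A.
Proof.
apply/matrixP => i j; rewrite !mxE.
by case: (ltngtP i j) => // eq_ij; rewrite (val_inj eq_ij).
Qed.

Lemma sym_upper_sym (F : fieldType) (a : nat) (A : 'M[F]_(a, a.+1)) :
  (sym_upper A)^T = sym_upper A.
Proof.
apply/matrixP => i j; rewrite !mxE.
by case: (ltngtP i j) => // eq_ij; rewrite (val_inj eq_ij).
Qed.

Lemma sym_lowerB (F : fieldType) (a : nat) (A B : 'M[F]_(a, a.+1)) :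
  sym_lower (A - B) = sym_lower A - sym_lower B.
Proof. by apply/matrixP => i j; rewrite !mxE; case: ifP. Qed.

Lemma sym_upperB (F : fieldType) (a : nat) (A B : 'M[F]_(a, a.+1)) :
  sym_upper (A - B) = sym_upper A - sym_upper B.
Proof. by apply/matrixP => i j; rewrite !mxE; case: ifP. Qed.

(** An entry [A i r] with [r <= i] is entry [(i, r)] of [sym_lower A]; otherwise it is entry
    [(i, r - 1)] of [sym_upper A]. *)
Lemma sym_lower_upper_inj (F : fieldType) (a : nat) (A : 'M[F]_(a, a.+1)) :
  sym_lower A = 0 -> sym_upper A = 0 -> A = 0.
Proof.
move=> /matrixP low0 /matrixP up0; apply/matrixP => i r; rewrite mxE.
case: (leqP r i) => [le_ri | lt_ir].
  have lt_ra : (r < a)%N by apply: leq_ltn_trans le_ri (ltn_ord i).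
  have := low0 i (Ordinal lt_ra); rewrite !mxE /= le_ri => <-.
  by congr (A _ _); apply: val_inj; rewrite /= /bump leqNgt lt_ra.
case: (unliftP ord0 r) lt_ir => [j -> | -> //]; rewrite lift0 ltnS => le_ij.
by have := up0 i j; rewrite !mxE le_ij.
Qed.

Definition file_P (F : fieldType) (a z : nat) (s : 'rV[F]_(a.+1 * (a * z)))
    (t : nat) : 'M[F]_a :=
  sym_lower (file_block s t).

(** The shift builds in [R 0 = 0], which starts both reconstruction and repair. *)
Definition file_R (F : fieldType) (a z : nat) (s : 'rV[F]_(a.+1 * (a * z)))
    (t : nat) : 'M[F]_a :=
  if t is u.+1 then sym_upper (file_block s u) else 0.

Lemma file_P_sym (F : fieldType) (a z : nat) (s : 'rV[F]_(a.+1 * (a * z)))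
    (t : nat) :
  (file_P s t)^T = file_P s t.
Proof. exact: sym_lower_sym. Qed.

Lemma file_R_sym (F : fieldType) (a z : nat) (s : 'rV[F]_(a.+1 * (a * z)))
    (t : nat) :
  (file_R s t)^T = file_R s t.
Proof. by case: t => [|t]; [rewrite trmx0 | apply: sym_upper_sym]. Qed.

(** * Linear encoding and helper maps *)

Definition encode (F : fieldType) (a z : nat) (e : F)
    (s : 'rV[F]_(a.+1 * (a * z))) : 'rV[F]_(a * z) :=
  mxvec (\matrix_(j, t) cell (file_P s) (file_R s) e t j 0).

Lemma encodeB (F : fieldType) (a z : nat) (e : F)
    (s s' : 'rV[F]_(a.+1 * (a * z))) :
  encode e (s - s') = encode e s - encode e s'.
Proof.
rewrite /encode -linearB; congr mxvec; apply/matrixP => j t.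
rewrite [LHS]mxE [RHS]mxE [X in _ = X + _]mxE [X in _ = _ + X]mxE.
rewrite [X in _ = _ - X]mxE.
have -> : cell (file_P (s - s')) (file_R (s - s')) e t =
    cell (file_P s) (file_R s) e t - cell (file_P s') (file_R s') e t.
  have RB u : file_R (s - s') u = file_R s u - file_R s' u.
    by case: u => [|u]; rewrite /file_R ?subr0 // file_blockB sym_upperB.
  rewrite /cell -mulmxBl !RB /file_P file_blockB sym_lowerB !scalerBr.
  by congr (_ *m _); rewrite !opprD [RHS]addrACA [X in _ = X + _]addrACA.
by rewrite !mxE.
Qed.

Lemma encode_cell (F : fieldType) (a z : nat) (e : F)
    (s : 'rV[F]_(a.+1 * (a * z))) (t : nat) :
  (t < z)%N -> column (vec_mx (encode e s)) t = cell (file_P s) (file_R s) e t.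
Proof.
move=> lt_tz; rewrite (columnE _ (Ordinal lt_tz)) mxvecK.
by apply/colP => j; rewrite !mxE.
Qed.

Lemma encode_eq0 (F : fieldType) (a z : nat) (e : F)
    (s : 'rV[F]_(a.+1 * (a * z))) :
  (forall t, (t < z)%N -> cell (file_P s) (file_R s) e t = 0) -> encode e s = 0.
Proof.
move=> eq0; rewrite /encode -[RHS](@linear0 _ _ _ _ mxvec); congr mxvec.
by apply/matrixP => j t; rewrite mxE eq0 // !mxE.
Qed.

Definition help (F : fieldType) (a z b i : nat) (eh ef : F) (v : 'rV[F]_(a * z)) :
    'rV[F]_b :=
  \row_(m < b) \sum_(u < i) (eh ^+ a * ef ^+ a) ^+ u
                 * dot ef (column (vec_mx v) (m * i + u)).

Lemma helpB (F : fieldType) (a z b i : nat) (eh ef : F) (v v' : 'rV[F]_(a * z)) :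
  help b i eh ef (v - v') = help b i eh ef v - help b i eh ef v'.
Proof.
apply/rowP => m; rewrite !mxE -sumrB; apply: eq_bigr => u _.
by rewrite /column linearB mulmxBl /dot mulmxBr !mxE mulrBr.
Qed.

(** * Reconstruction and repair for the encoded file *)

Lemma encode_reconstruction (F : finFieldType) (n a z : nat) (e : 'I_n -> F) :
  injective (fun h => e h ^+ a) -> (forall h, e h != 0) ->
  data_reconstruction a.+1 (fun h => @encode F a z (e h)).
Proof.
move=> inj_ea e_neq0 K cardK.
have inj_e : injective e by move=> h h' eq_e; apply: inj_ea; rewrite /= eq_e.
pose f s := [ffun j : {j | j \in K} => @encode F a z (e (val j)) s].
(* By linearity it suffices that a difference of files with zero content on [K] is zero. *)
apply: (@decoder_exists _ _ _ f id 0) => s s' /ffunP eq_f.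
apply/eqP; rewrite -subr_eq0; apply/eqP/file_block_inj => t lt_tz.
suff [] : file_P (s - s') t = 0 /\ file_R (s - s') t.+1 = 0.
  exact: sym_lower_upper_inj.
apply: (@cells_determine F _ a z e K) lt_tz => //.
- by move=> h h' _ _; apply: inj_e.
- by move=> h h' _ _; apply: inj_ea.
- by rewrite cardK.
- exact: file_P_sym.
- exact: file_R_sym.
move=> h u hK lt_uz; rewrite -encode_cell // encodeB.
have := eq_f (exist _ h hK); rewrite !ffunE /= => ->.
by rewrite subrr linear0 /column mul0mx.
Qed.

Lemma encode_repair (F : finFieldType) (n a z i : nat) (e : 'I_n -> F) :
  injective e -> (forall h, e h != 0) -> (0 < i)%N -> (i %| z)%N ->
  exact_repair (i.+1 * a) (z %/ i) (fun h => @encode F a z (e h)).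
Proof.
move=> inj_e e_neq0 i_gt0 dvd_iz f H cardH _.
pose hlp (h : {h | h \in H}) := @help F a z (z %/ i) i (e (val h)) (e f).
exists hlp.
pose resp s := [ffun h : {h | h \in H} => hlp h (@encode F a z (e (val h)) s)].
apply: (@decoder_exists _ _ _ resp (@encode F a z (e f)) 0) => s s' /ffunP eq_r.
apply/eqP; rewrite -subr_eq0 -encodeB; apply/eqP/encode_eq0.
(* Since [i] divides [z], the [z] cells form exactly [z %/ i] windows. *)
rewrite -{1}(divnK dvd_iz); apply: (@repair_cells F _ a i (z %/ i) e H) => //.
- by move=> h h' _ _; apply: inj_e.
- by rewrite cardH.
- exact: file_P_sym.
- exact: file_R_sym.
move=> h m hH lt_m.
have /rowP/(_ (Ordinal lt_m)) :
    help (z %/ i) i (e h) (e f) (encode (e h) (s - s')) = 0.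
  rewrite encodeB helpB; apply/eqP; rewrite subr_eq0; apply/eqP.
  by have := eq_r (exist _ h hH); rewrite /resp [LHS]ffunE [RHS]ffunE.
rewrite [X in X = _]mxE [X in _ = X]mxE => E.
rewrite -[RHS]E; apply: eq_bigr => u _.
rewrite encode_cell //= -(divnK dvd_iz).
apply: (@leq_trans (m.+1 * i)); last by rewrite leq_mul2r lt_m orbT.
by rewrite mulSn addnC ltn_add2r.
Qed.

(** * Capacity bound and evaluation points *)

(** Counting: files inject into the contents of [k] nodes, so [q ^ B <= q ^ (k * alpha)] with
    [q > 1]. *)
Lemma reconstruction_capacity (F : finFieldType) (n k B alpha : nat)
    (x : 'I_n -> 'rV[F]_B -> 'rV[F]_alpha) :
  (k <= n)%N -> data_reconstruction k x -> (B <= k * alpha)%N.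
Proof.
move=> le_kn rec.
have [K cardK] : exists K : {set 'I_n}, #|K| = k.
  have : (0 < #|[set A : {set 'I_n} | #|A| == k]|)%N.
    by rewrite card_draws card_ord bin_gt0.
  by case/card_gt0P => K; rewrite inE => /eqP; exists K.
have [dec decK] := rec K cardK.
have /leq_card : injective (fun s => [ffun j : {j | j \in K} => x (val j) s]).
  exact: can_inj decK.
rewrite card_ffun !card_mx card_sig !mul1n -expnM leq_exp2l ?card_finNzRing_gt1 //.
by rewrite (eq_card (B := K)) // cardK mulnC.
Qed.

(** As [h.+1 ^ a <= n ^ a < p], reduction modulo [p] keeps these powers distinct. *)
Lemma nonzero_points (n a : nat) :
  (0 < a)%N -> exists (F : finFieldType) (e : 'I_n -> F),
    injective (fun h => e h ^+ a) /\ (forall h, e h != 0).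
Proof.
move=> a_gt0; have [p lt_p pr_p] := prime_above (n ^ a).
have small (h : 'I_n) : (h.+1 ^ a < p)%N.
  by apply: leq_ltn_trans lt_p; rewrite leq_exp2r.
exists 'F_p, (fun h => h.+1%:R); split=> [h h' | h].
  rewrite /= -!natrX => /(congr1 val) /=; rewrite !val_Fp_nat // !modn_small //.
  by move=> /eqP; rewrite eqn_exp2r // => /eqP [] /val_inj.
apply/eqP => /(congr1 val) /=; rewrite val_Fp_nat // modn_small //.
apply: leq_ltn_trans (small h); rewrite -{1}(expn1 h.+1).
exact: leq_pexp2l.
Qed.

(** * Parameters and optimality of the MSR code *)

Theorem theorem1 (n k delta : nat) (hn : (0 < n)%N) (hdelta : (0 < delta)%N)
    (hk : (2 <= k)%N) (hkn : (k <= n)%N) :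
  let alpha : nat := ((k - 1) * \big[lcmn/1]_(1 <= j < delta.+1) j)%N in
  let d (i : nat) : nat := ((i + 1) * (k - 1))%N in
  let D : seq nat := [seq d i | i <- iota 1 delta] in
  let beta (e : nat) : rat := alpha%:R / (e%:R - k%:R + 1) in
  let gamma (e : nat) : rat := e%:R * beta e in
  (exists (Fq : finFieldType)
          (x : 'I_n -> 'rV[Fq]_(k * alpha) -> 'rV[Fq]_alpha),
     adaptive_MSR_code k D gamma x) /\
  total_storage_capacity n k D alpha gamma (k * alpha).
Proof.
case: k hk hkn => // a a_gt0 lt_an; rewrite ltnS in a_gt0.
rewrite subSS subn0; set z := \big[lcmn/1%N]_(1 <= j < _) j => alpha d D beta gamma.
have dvd_z i : (0 < i <= delta)%N -> (i %| z)%N.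
  move=> i_bounds; rewrite /z (bigD1_seq i) ?iota_uniq //= ?dvdn_lcml //.
  by rewrite mem_index_iota ltnS.
have DP e : e \in D -> exists2 i, (0 < i <= delta)%N & e = (i.+1 * a)%N.
  case/mapP => i; rewrite mem_iota add1n ltnS => i_bounds ->.
  by exists i; rewrite // /d addn1.
(* With [k = a + 1], [d_i - k + 1 = i * a], so [beta(d_i) = a * z / (i * a)] is the integer
   [z %/ i]. *)
have denom i : (i.+1 * a)%:R - a.+1%:R + 1 = (i * a)%:R :> rat.
  by rewrite mulSn natrD -natr1; ring.
have betaE i : (0 < i <= delta)%N -> beta (i.+1 * a)%N = (z %/ i)%:R.
  move=> i_bounds; rewrite /beta denom /alpha.
  have /andP[i_gt0 _] := i_bounds.
  rewrite -{1}(divnK (dvd_z _ i_bounds)) mulnC -mulnA.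
  by rewrite natrM mulfK // pnatr_eq0 -lt0n muln_gt0 i_gt0.
have per_helperE e : e \in D -> per_helper gamma e = beta e.
  case/DP => i _ ->; rewrite /per_helper /gamma mulrAC divff ?mul1r //.
  by rewrite pnatr_eq0 -lt0n muln_gt0.
have [F [e [inj_ea e_neq0]]] := nonzero_points n a_gt0.
have inj_e : injective e by move=> h h' eq_e; apply: inj_ea; rewrite /= eq_e.
pose x (h : 'I_n) := @encode F a z (e h).
have code : adaptive_regenerating_code a.+1 D gamma x.
  split.
  - rewrite sorted_map; apply: (sub_sorted _ (iota_ltn_sorted 1 delta)).
    by move=> i j lt_ij; rewrite /relpre /= /d ltn_pmul2r // ltn_add2r.
  - move=> f fD; have [i i_bounds def_f] := DP f fD.
    have /andP[i_gt0 _] := i_bounds.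
    split; first by rewrite def_f muln_gt0.
    rewrite /gamma def_f betaE // -natrM ler_nat /alpha.
    (* Writing [z] as [z %/ i * i], the bound compares [i] with [i + 1] times [a * (z %/ i)]. *)
    rewrite -{1}(divnK (dvd_z _ i_bounds)) mulnCA mulnC [(a * i)%N]mulnC.
    by rewrite !leq_mul2r leqnSn !orbT.
  - exact: encode_reconstruction.
  - move=> f fD; have [i i_bounds def_f] := DP f fD.
    exists (z %/ i)%N; first by rewrite per_helperE // def_f betaE.
    rewrite def_f; apply: encode_repair; rewrite ?dvd_z //.
    by case/andP: i_bounds.
have capacity : total_storage_capacity n a.+1 D alpha gamma (a.+1 * alpha).
  split; first by exists F, x.
  move=> Fq B y [_ _ rec _]; exact: reconstruction_capacity rec.
split=> //; exists F, x; split=> // f fD.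
rewrite per_helperE //; have [i /andP[i_gt0 _] ->] := DP f fD.
by rewrite /beta mulrC divfK // denom pnatr_eq0 -lt0n muln_gt0 i_gt0.
Qed.
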